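(* Let $\gamma\in(0,1)$ and let $\{\pi^k\}_{k\ge0}$ be generated by soft policy iteration (soft PI) from an initial policy $\pi^0$. Let $$a_0:=\frac{1}{2\tau}\cdot\frac{\gamma^2}{1-\gamma}\,\|V_\tau^*-V_\tau^0\|_\infty$$ and $$k_0=\begin{cases}1&\text{if }a_0\le1,\\2+\dfrac{\log a_0}{\log\frac1\gamma}&\text{if }a_0>1.\end{cases}$$ Then for all $k\ge k_0$, $$\|V_\tau^*-V_\tau^k\|_\infty\le\frac{2\tau(1-\gamma)}{\gamma^2}\,\gamma^{\,2^{\,k-k_0}}.$$
   Context: MDP: a tuple $(\mathcal{S},\mathcal{A},P,r,\gamma)$ with finite state space $\mathcal{S}$, finite action space $\mathcal{A}$, transition probabilities $P(s'|s,a)$, reward $r:\mathcal{S}\times\mathcal{A}\to[0,1]$ and discount factor $\gamma$. A policy is $\pi=(\pi(\cdot|s))_{s\in\mathcal{S}}$ with each $\pi(\cdot|s)$ a probability distribution on $\mathcal{A}$. For a regularization parameter $\tau>0$, the entropy regularized values are $V_\tau^\pi(s)=\mathbb{E}[\sum_{t\ge0}\gamma^t(r(s_t,a_t)-\tau\log\pi(a_t|s_t))\mid s_0=s,\pi]$ and $Q_\tau^\pi(s,a)=r(s,a)+\gamma\,\mathbb{E}_{s'\sim P(\cdot|s,a)}[V_\tau^\pi(s')]$. $V_\tau^*(s)=\max_\pi V_\tau^\pi(s)$ is the optimal regularized value. For policies $\pi^k$, write $V_\tau^k,Q_\tau^k$ for $V_\tau^{\pi^k},Q_\tau^{\pi^k}$.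 $\|\cdot\|_\infty$ is the maximum absolute entry. Soft PI: $\pi^{k+1}(a|s)=\dfrac{\exp(Q_\tau^k(s,a)/\tau)}{\sum_{a'}\exp(Q_\tau^k(s,a')/\tau)}$ for all $s,a$. *)

(* Defs.v *)
From HB Require Import structures.
From mathcomp Require Import all_boot all_order all_algebra.
From mathcomp Require Import all_classical all_reals all_analysis.
From mathcomp Require Import ring.

Set Implicit Arguments.
Unset Strict Implicit.
Unset Printing Implicit Defensive.

Import Order.TTheory GRing.Theory Num.Theory.
Import numFieldNormedType.Exports.

Local Open Scope classical_set_scope.
Local Open Scope ring_scope.

Record dist (R : realType) (T : finType) := Dist {
  pmf :> T -> R;
  pmf_ge0 : forall x, 0 <= pmf x;
  pmf_sum1 : \sum_x pmf x = 1 }.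

Record mdp (R : realType) (S A : finType) := MDP {
  trans : S -> A -> dist R S;
  reward : S -> A -> R;
  discount : R;
  reward_itv : forall s a, 0 <= reward s a <= 1 }.

Definition policy (R : realType) (S A : finType) := S -> dist R A.

(* The process (s_t, a_t) generated by [pi] from s_0 = s, on some probability
   space. The law of every finite prefix is given, hence so is the law of the
   whole trajectory. *)
Record trajectory (R : realType) (S A : finType) (M : mdp R S A)
    (pi : policy R S A) (s : S) := Trajectory {
  disp : measure_display;
  space : measurableType disp;
  prob : probability space R;
  state : nat -> space -> S;
  action : nat -> space -> A;
  measurable_state : forall t x, measurable [set w | state t w = x];
  measurable_action : forall t a, measurable [set w | action t w = a];
  trajectory_law : forall n (x : nat -> S) (a : nat -> A),
    prob [set w | forall t, (t <= n)%N -> state t w = x t /\ action t w = a t]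
    = ((x 0%N == s)%:R * (\prod_(t < n.+1) pi (x t) (a t))
       * \prod_(t < n) trans M (x t) (a t) (x t.+1))%:E }.

(* Realization of a finite-state discrete-time process on [0, 1[ with the uniform
   probability: each finite history corresponds to an interval whose length is
   the probability of that history. Histories list the latest state first. *)
Section chain.
Variables (R : realType) (X : finType) (x0 : X).
Variable (F : seq X -> X -> R).
Hypothesis F_ge0 : forall h x, 0 <= F h x.
Hypothesis F_sum1 : forall h, \sum_x F h x = 1.

Let cum h (k : nat) := \sum_(y <- take k (enum X)) F h y.

Let cumS h x : cum h (index x (enum X)).+1 = cum h (index x (enum X)) + F h x.
Proof.
rewrite /cum (take_nth x) ?index_mem ?mem_enum// -cats1 big_cat /= big_seq1.
by rewrite nth_index ?mem_enum.
Qed.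

Let cum_le h k l : (k <= l)%N -> cum h k <= cum h l.
Proof.
move=> kl; rewrite /cum -(subnKC kl) takeD big_cat /= lerDl.
by apply: sumr_ge0 => *; exact: F_ge0.
Qed.

Let cum0 h : cum h 0 = 0. Proof. by rewrite /cum take0 big_nil. Qed.

Let cum1 h : cum h #|X| = 1.
Proof. by rewrite /cum cardE take_size big_enum /= F_sum1. Qed.

Fixpoint chain_mass (h : seq X) : R :=
  if h is x :: h' then chain_mass h' * F h' x else 1.

Fixpoint chain_left (h : seq X) : R :=
  if h is x :: h'
  then chain_left h' + chain_mass h' * cum h' (index x (enum X)) else 0.

Definition chain_itv (h : seq X) : set R :=
  `[chain_left h, chain_left h + chain_mass h[.

Let inI h u : chain_itv h u <-> chain_left h <= u < chain_left h + chain_mass h.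
Proof. by rewrite /chain_itv /= in_itv. Qed.

Let mass_ge0 h : 0 <= chain_mass h.
Proof. by elim: h => [|x h ih]//=; rewrite mulr_ge0. Qed.

Let inIcons x h u : chain_itv (x :: h) u <->
  chain_left h + chain_mass h * cum h (index x (enum X)) <= u
  < chain_left h + chain_mass h * cum h (index x (enum X)).+1.
Proof. by rewrite inI /= cumS mulrDr addrA. Qed.

Let subI x h : chain_itv (x :: h) `<=` chain_itv h.
Proof.
move=> u /inIcons /andP[lu ur]; apply/inI/andP; split.
  apply: le_trans lu; rewrite lerDl mulr_ge0//.
  by rewrite -(cum0 h) cum_le.
apply: (lt_le_trans ur); rewrite lerD2l ler_piMr// -(cum1 h) cum_le//.
by rewrite cardE index_mem mem_enum.
Qed.

Let uniqI x y h u : chain_itv (x :: h) u -> chain_itv (y :: h) u -> x = y.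
Proof.
wlog xy : x y / (index x (enum X) <= index y (enum X))%N => [hw Hx Hy|].
  have [/hw|/ltnW/hw] := leqP (index x (enum X)) (index y (enum X)); first exact.
  by move=> ->.
move=> /inIcons /andP[_ ux] /inIcons /andP[uy _].
move: xy; rewrite leq_eqVlt => /orP[/eqP e|xy].
  have := congr1 (nth x (enum X)) e; rewrite !nth_index ?mem_enum//.
have := le_lt_trans uy ux; rewrite ltrD2l ltNge ler_wpM2l//; exact: cum_le.
Qed.

Let existsI h u : chain_itv h u -> exists x, chain_itv (x :: h) u.
Proof.
move=> /inI /andP[lu ur].
pose Q k := u < chain_left h + chain_mass h * cum h k.
have exQ : exists k, Q k by exists #|X|; rewrite /Q cum1 mulr1.
case: (ex_minnP exQ) => -[|k]; rewrite /Q.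
  by rewrite cum0 mulr0 addr0 ltNge lu.
move=> uk mink.
have kX : (k < #|X|)%N by apply: mink; rewrite /Q cum1 mulr1.
exists (nth x0 (enum X) k); apply/inIcons.
rewrite index_uniq ?enum_uniq -?cardE// uk andbT leNgt.
by apply/negP => /mink; rewrite ltnn.
Qed.

Definition chain_step (h : seq X) (u : R) : X :=
  odflt x0 [pick x | `[< chain_itv (x :: h) u >]].

Fixpoint chain_hist (n : nat) (u : R) : seq X :=
  if n is n'.+1 then chain_step (chain_hist n' u) u :: chain_hist n' u
  else [::].

Let stepP x h u : chain_itv (x :: h) u -> chain_step h u = x.
Proof.
move=> hx; rewrite /chain_step; case: pickP => [y /asboolP hy|/(_ x)] /=.
  exact: uniqI hy hx.
by move=> /asboolP.
Qed.

Let histI n u : 0 <= u < 1 -> chain_itv (chain_hist n u) u.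
Proof.
move=> u01; elim: n => [|n ih] /=; first by apply/inI; rewrite /= add0r.
by have [x hx] := existsI ih; rewrite (stepP hx).
Qed.

Let size_hist n u : size (chain_hist n u) = n.
Proof. by elim: n => //= n ->. Qed.

Let histP h u : chain_itv h u -> chain_hist (size h) u = h.
Proof.
elim: h => //= x h ih hx; rewrite ih; last exact: subI hx.
by rewrite (stepP hx).
Qed.

Let I01 h u : chain_itv h u -> 0 <= u < 1.
Proof.
elim: h => [/inI /=|x h ih /subI]//; by rewrite add0r.
Qed.

Let measurable_chain_itv h : measurable (chain_itv h).
Proof. exact: measurable_itv. Qed.

Let measurable_step h x : measurable [set u | chain_step h u = x].
Proof.
have -> : [set u | chain_step h u = x] = chain_itv (x :: h) `|`
    ([set _ | x = x0] `&` ~` \bigcup_(y in [set: X]) chain_itv (y :: h)).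
  apply/seteqP; split => u /=.
    rewrite /chain_step; case: pickP => [y /asboolP hy /= <-|nI /= <-].
      by left.
    by right; split=> // -[y _ hy]; have := nI y; rewrite asboolT.
  case=> [/stepP //|[-> nI]]; rewrite /chain_step; case: pickP => //= y.
  by move=> /asboolP hy; case: nI; exists y.
apply: measurableU => //; apply: measurableI.
  have [xx0|xx0] := eqVneq x x0.
    rewrite [X in measurable X](_ : _ = setT); first exact: measurableT.
    by apply/seteqP; split => u.
  rewrite [X in measurable X](_ : _ = set0); first exact: measurable0.
  by apply/seteqP; split => u //= /eqP; rewrite (negbTE xx0).
apply: measurableC; apply: fin_bigcup_measurable => //.
Qed.

Let measurable_hist h : measurable [set u | chain_hist (size h) u = h].
Proof.
elim: h => [|x h ih] /=; first by rewrite (_ : mkset _ = setT)//; apply/seteqP.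
rewrite (_ : mkset _ = [set u | chain_hist (size h) u = h] `&`
                       [set u | chain_step h u = x]).
  exact: measurableI.
by apply/seteqP; split => u /=; [case=> <- hh; rewrite hh|case=> -> ->].
Qed.

Definition chain_state (t : nat) (u : R) : X := head x0 (chain_hist t.+1 u).

Lemma measurable_chain_state t x : measurable [set u | chain_state t u = x].
Proof.
rewrite (_ : mkset _ = \bigcup_(h in [set: t.-tuple X])
    [set u | chain_hist (size (x :: h)) u = x :: h]).
  by apply: fin_bigcup_measurable => // h _; exact: measurable_hist.
apply/seteqP; split => u /=.
  have sh : size (chain_hist t u) == t by rewrite size_hist.
  by move=> e; exists (Tuple sh) => //=; rewrite (eqP sh) -e.
case=> h _ /= [<- _]; rewrite /chain_state /= size_tuple//.
Qed.

Fixpoint past (x : nat -> X) (n : nat) : seq X :=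
  if n is n'.+1 then x n' :: past x n' else [::].

Let size_past x n : size (past x n) = n.
Proof. by elim: n => //= n ->. Qed.

Let chain_histP x n u :
  (forall t, (t < n)%N -> chain_state t u = x t) <-> chain_hist n u = past x n.
Proof.
elim: n => [|n ih]/=; first by split.
split=> [H|[e1 e2] t].
  have e : chain_hist n u = past x n by apply/ih => t tn; apply/H/ltnW.
  by have := H n (ltnSn n); rewrite /chain_state /= => ->; rewrite e.
rewrite ltnS leq_eqVlt => /orP[/eqP ->//|tn]; exact: (ih.2 e2).
Qed.

Let uniformE (E : set R) : measurable E ->
  uniform_prob (@ltr01 R) E = lebesgue_measure (E `&` `[0, 1[).
Proof.
move=> mE; rewrite /uniform_prob integral_uniform_pdf.
have m01 : measurable (E `&` `[0, 1]) by exact: measurableI.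
under eq_integral => x.
  rewrite inE => -[_ /=]; rewrite in_itv /= /uniform_pdf => ->.
  rewrite subr0 invr1; over.
rewrite integral_cst// mul1e; apply/eqP; rewrite eq_le; apply/andP; split.
  apply: (@le_trans _ _ (lebesgue_measure ((E `&` `[0, 1[) `|` [set 1%R]))).
    apply: le_measure; rewrite ?inE//.
      by apply: measurableU => //; exact: measurableI.
    move=> x [Ex /=]; rewrite !in_itv/= => /andP[-> x1].
    by have := x1; rewrite le_eqVlt => /orP[/eqP|->]; [right|left].
  apply: le_trans (measureU2 _ _ _) _ => //=; first exact: measurableI.
  by rewrite lebesgue_measure_set1 adde0.
apply: le_measure; rewrite ?inE//; first exact: measurableI.
by move=> x [Ex /=]; rewrite !in_itv/= => /andP[-> /ltW ->].
Qed.

Lemma chain_law (x : nat -> X) (n : nat) :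
  uniform_prob (@ltr01 R) [set u | forall t, (t < n)%N -> chain_state t u = x t]
  = (chain_mass (past x n))%:E.
Proof.
have -> : [set u | forall t, (t < n)%N -> chain_state t u = x t] =
    [set u | chain_hist (size (past x n)) u = past x n].
  by rewrite size_past; apply/seteqP; split => u /chain_histP.
rewrite uniformE; last exact: measurable_hist.
set h := past x n.
rewrite (_ : _ `&` _ = chain_itv h).
  rewrite /chain_itv lebesgue_measure_itv /= lte_fin ltrDl lt_neqAle mass_ge0.
  rewrite andbT eq_sym; case: eqVneq => [->//|_] /=.
  by rewrite -EFinD addrC addKr.
apply/seteqP; split => u /=.
  by case=> <-; rewrite in_itv /= => /histI.
by move=> hu; split; [exact: histP|rewrite in_itv /=; exact: I01 hu].
Qed.

End chain.

Section existence.
Variables (R : realType) (S A : finType) (M : mdp R S A) (pi : policy R S A).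
Variable (s : S).

Let step_prob (h : seq (S * A)) (x : S * A) : R :=
  (if h is y :: _ then trans M y.1 y.2 x.1 else (x.1 == s)%:R) * pi x.1 x.2.

Let step_prob_ge0 h x : 0 <= step_prob h x.
Proof. by apply: mulr_ge0; [case: h => [|y h]; rewrite ?pmf_ge0|exact: pmf_ge0]. Qed.

Let step_prob_sum1 h : \sum_x step_prob h x = 1.
Proof.
rewrite -(pair_bigA _ (fun a b => step_prob h (a, b))) /= /step_prob /=.
under eq_bigr => s' _ do rewrite -mulr_sumr pmf_sum1 mulr1.
case: h => [|y h]; last exact: pmf_sum1.
rewrite (bigD1 s) //= eqxx big1 ?addr0// => s' /negbTE ->//.
Qed.

Let start : S * A.
Proof.
have [a _|A0] := pickP (fun _ : A => true); first exact: (s, a).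
have := pmf_sum1 (pi s); rewrite big_pred0// => /eqP.
by rewrite eq_sym oner_eq0.
Qed.

Let step_prob_mass (x : nat -> S) (a : nat -> A) n :
  chain_mass step_prob (past (fun t => (x t, a t)) n.+1) =
  (x 0%N == s)%:R * (\prod_(t < n.+1) pi (x t) (a t))
  * \prod_(t < n) trans M (x t) (a t) (x t.+1).
Proof.
elim: n => [|n ih].
  by rewrite /= /step_prob /= big_ord_recr !big_ord0 /= !mul1r mulr1.
have -> : chain_mass step_prob (past (fun t => (x t, a t)) n.+2) =
    chain_mass step_prob (past (fun t => (x t, a t)) n.+1) *
    (trans M (x n) (a n) (x n.+1) * pi (x n.+1) (a n.+1)) by [].
rewrite ih [X in _ = _ * X * _]big_ord_recr [X in _ = _ * X]big_ord_recr /=.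
by ring.
Qed.

Lemma trajectory_exists : inhabited (trajectory M pi s).
Proof.
pose w t := chain_state start step_prob t.
have mw t x : measurable [set u | w t u = x].
  exact: measurable_chain_state.
constructor; apply: (@Trajectory _ _ _ M pi s _ _ (uniform_prob (@ltr01 R))
  (fun t u => (w t u).1) (fun t u => (w t u).2)).
- move=> t x; rewrite (_ : mkset _ =
    \bigcup_(a in [set: A]) [set u | w t u = (x, a)]).
    by apply: fin_bigcup_measurable => // *; exact: mw.
  by apply/seteqP; split => u /=; [move=> <-; exists (w t u).2 => //=;
    rewrite -surjective_pairing|case=> a _ /= ->].
- move=> t a; rewrite (_ : mkset _ =
    \bigcup_(x in [set: S]) [set u | w t u = (x, a)]).
    by apply: fin_bigcup_measurable => // *; exact: mw.
  by apply/seteqP; split => u /=; [move=> <-; exists (w t u).1 => //=;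
    rewrite -surjective_pairing|case=> x _ /= ->].
- move=> n x a; rewrite -step_prob_mass.
  rewrite -(@chain_law _ _ start _ step_prob_ge0 step_prob_sum1).
  congr (uniform_prob _ _); apply/seteqP; split => u /= H t tn.
    by have [<- <-] := H t tn; rewrite -surjective_pairing.
  by rewrite /w (H t tn).
Qed.

End existence.

Section values.
Variables (R : realType) (S A : finType) (M : mdp R S A) (tau : R).
Implicit Types pi : policy R S A.

(* The value of the integrals below only depends on [trajectory_law], hence not
   on which process is chosen. *)
Definition traj pi s : trajectory M pi s :=
  inhabited_witness (trajectory_exists M pi s).

(* [ln 0 = 0]; actions with [pi s a = 0] are taken with probability 0. *)
Definition discounted_return pi s (w : space (traj pi s)) : R :=
  limn (fun n => \sum_(0 <= t < n) discount M ^+ t *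
    (reward M (state t w) (action t w)
     - tau * ln (pi (state t w) (action t w)))).

Definition Vreg pi s : R := fine 'E_(prob (traj pi s))[@discounted_return pi s].

Definition Qreg pi s a : R :=
  reward M s a + discount M * \sum_(s' : S) trans M s a s' * Vreg pi s'.

(* V^*_tau; the supremum is attained when tau > 0 and 0 <= discount M < 1. *)
Definition Vopt s : R := sup [set Vreg pi s | pi in [set: policy R S A]].

Definition soft_PI (pi : nat -> policy R S A) : Prop :=
  forall k s a, pi k.+1 s a =
    expR (Qreg (pi k) s a / tau) / \sum_(a' : A) expR (Qreg (pi k) s a' / tau).

End values.

Definition norm_infty (R : realType) (S : finType) (f : S -> R) : R :=
  \big[Num.max/0]_(s : S) `|f s|.

(* Main.v *)
(* Soft policy iteration is Newton-like: writing V for the value of the current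
   policy and pi' for the softmax of its action values, V_{pi'} differs from V^*
   by at most 1/(1 - gamma) times the defect in the optimality equation at V^* of
   pi', and this defect is tau times the Kullback-Leibler divergence from pi' to
   the optimal policy, the softmax at V^*. Log-sum-exp being smooth, the
   divergence is quadratic in the distance between the two families of action
   values, so the scaled error a_k := gamma^2 / (2 tau (1 - gamma)) |V^* - V_k|
   satisfies a_{k+1} <= a_k^2 as well as a_{k+1} <= gamma a_k. The linear rate
   brings a_k below 1, then below gamma, after which squaring takes over. *)
Require Import Defs.
From mathcomp Require Import all_boot all_order all_algebra.
From mathcomp Require Import all_classical all_reals all_analysis.
From mathcomp Require Import measurable_realfun ring lra.

Set Implicit Arguments.
Unset Strict Implicit.
Unset Printing Implicit Defensive.

Import Order.TTheory GRing.Theory Num.Theory.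
Import numFieldNormedType.Exports.

Local Open Scope classical_set_scope.
Local Open Scope ring_scope.

(** * Total probability and expectation for finite-valued random variables *)

Section finite_valued.
Context d (W : measurableType d) (R : realType) (P : probability W R).
Context (T : finType) (X : W -> T).
Hypothesis mX : forall x, measurable [set w | X w = x].

Lemma prob_fibers (E : set W) : measurable E ->
  fine (P E) = \sum_x fine (P (E `&` [set w | X w = x])).
Proof.
move=> mE; have mEX x : measurable (E `&` [set w | X w = x]).
  exact: measurableI.
apply: EFin_inj; rewrite fineK ?fin_num_measure// -sumEFin.
under eq_bigr => x _ do rewrite fineK ?fin_num_measure//.
rewrite [RHS]fsbig_seq ?index_enum_uniq//=.
rewrite -measure_fin_bigcup//; last by move=> x y _ _ [w [[_ /= <-] [_ /= <-]]].
rewrite -setI_bigcupr; congr (P _); apply/seteqP; split=> [w Ew|w []//].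
by split=> //; exists (X w) => //=; rewrite mem_index_enum.
Qed.

Lemma measurable_finite_valued (f : T -> R) : measurable_fun setT (f \o X).
Proof.
move=> _ Y mY; rewrite setTI.
rewrite (_ : _ @^-1` Y = \bigcup_(x in [set x | Y (f x)]) [set w | X w = x]).
  by apply: fin_bigcup_measurable => // x _; exact: mX.
by apply/seteqP; split=> w /=; [exists (X w)|case=> x /= Yx ->].
Qed.

Lemma expectation_finite_valued (f : T -> R) :
  ('E_P[f \o X] = (\sum_x f x * fine (P [set w | X w = x]))%:E)%E.
Proof.
rewrite unlock.
transitivity (\int[P]_w \sum_x ((f x)%:E * (\1_[set w | X w = x] w)%:E))%E.
  apply: eq_integral => w _ /=; rewrite (bigD1 (X w)) //= big1.
    by rewrite indicE mem_set//= mule1 adde0.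
  by move=> x /eqP xw; rewrite indicE memNset ?mule0//= => /esym.
have iX x : P.-integrable setT (fun w => (\1_[set w | X w = x] w)%:E).
  exact: integrable_indic.
rewrite integral_sum// => [|x]; last exact: integrableZl.
rewrite -sumEFin; apply: eq_bigr => x _; rewrite integralZl// integral_indic//.
by rewrite setIT EFinM fineK// fin_num_measure.
Qed.

End finite_valued.

(** * Means under a finite distribution *)

Section dist_mean.
Variables (R : realType) (T : finType) (p : dist R T).
Implicit Types (f g : T -> R).

Lemma ler_mean f g : (forall x, f x <= g x) ->
  \sum_x p x * f x <= \sum_x p x * g x.
Proof.
move=> fg; apply: ler_sum => x _; apply: ler_wpM2l (fg x); exact: Defs.pmf_ge0.
Qed.

Lemma mean_cst c : \sum_x p x * c = c.
Proof. by rewrite -mulr_suml Defs.pmf_sum1 mul1r. Qed.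

Lemma mean_affine f c k : \sum_x p x * (c + k * f x) = c + k * \sum_x p x * f x.
Proof.
rewrite mulr_sumr -[X in X + _]mean_cst -big_split /=.
by apply: eq_bigr => x _; rewrite mulrDr mulrCA.
Qed.

Lemma ler_norm_mean f c : (forall x, `|f x| <= c) -> `|\sum_x p x * f x| <= c.
Proof.
move=> fc; rewrite -[leRHS]mean_cst; apply: le_trans (ler_norm_sum _ _ _) _.
apply: ler_sum => x _; rewrite normrM ger0_norm ?Defs.pmf_ge0//.
by apply: ler_wpM2l (fc x); exact: Defs.pmf_ge0.
Qed.

End dist_mean.

(** * Convergence and uniform bounds for discounted series *)

Section discounted_series.
Variables (R : realType) (gamma B : R) (c : nat -> R).
Hypotheses (hgamma : 0 <= gamma < 1) (cB : forall t, `|c t| <= B).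

Let discount_normE t : `|gamma ^+ t * c t| = gamma ^+ t * `|c t|.
Proof. by rewrite normrM ger0_norm// exprn_ge0//; case/andP: hgamma. Qed.

Lemma is_cvg_discounted : cvgn (fun n => \sum_(0 <= t < n) gamma ^+ t * c t).
Proof.
have [g0 g1] := andP hgamma.
apply: (@normed_cvg _ _ (fun t => gamma ^+ t * c t)).
apply: (@series_le_cvg _ _ (geometric B gamma)) => [t|t|t|].
- exact: normr_ge0.
- by rewrite /= mulr_ge0 ?exprn_ge0// (le_trans _ (cB 0)).
- by rewrite /= discount_normE mulrC ler_wpM2r// exprn_ge0.
- by apply: is_cvg_geometric_series; rewrite ger0_norm.
Qed.

Lemma discounted_bound n :
  `|\sum_(0 <= t < n) gamma ^+ t * c t| <= B / (1 - gamma).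
Proof.
have [g0 g1] := andP hgamma.
have g1' : 0 < 1 - gamma by rewrite subr_gt0.
have B0 : 0 <= B by rewrite (le_trans _ (cB 0)).
apply: le_trans (ler_norm_sum _ _ _) _.
apply: (@le_trans _ _ (B * \sum_(0 <= t < n) gamma ^+ t)).
  rewrite mulr_sumr; apply: ler_sum => t _.
  by rewrite discount_normE mulrC ler_wpM2r// exprn_ge0.
apply: ler_wpM2l => //; rewrite -[leRHS]mul1r ler_pdivlMr// big_mkord mulrC.
by rewrite -opprB mulNr -subrX1 opprB gerBl exprn_ge0.
Qed.

End discounted_series.

(** * Expected discounted sums through powers of the transition operator *)

Section trajectory_bellman.
Variables (R : realType) (S A : finType) (M : mdp R S A) (pi : policy R S A).
Implicit Types (f : S * A -> R) (z : nat -> S * A) (y : S * A).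

(** The transition operator on state-action pairs: the conditional mean of [f] at the next pair,
    given that the current one is [y]. *)
Definition step_exp f y : R :=
  \sum_(s' : S) trans M y.1 y.2 s' * \sum_(b : A) pi s' b * f (s', b).

Lemma step_exp_bound f B :
  (forall y, `|f y| <= B) -> forall y, `|step_exp f y| <= B.
Proof. by move=> fB y; do 2!(apply: ler_norm_mean => ?). Qed.

Lemma iter_step_exp_bound f B t :
  (forall y, `|f y| <= B) -> forall y, `|iter t step_exp f y| <= B.
Proof. by move=> fB; elim: t => //= t; exact: step_exp_bound. Qed.

Lemma step_exp_sum (n : nat) (F : nat -> S * A -> R) (k : nat -> R) y :
  \sum_(0 <= t < n) k t * step_exp (F t) y =
  step_exp (fun y' => \sum_(0 <= t < n) k t * F t y') y.
Proof.
rewrite /step_exp; under eq_bigr => t _ do rewrite mulr_sumr.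
rewrite exchange_big; apply: eq_bigr => s' _ /=.
under eq_bigr => t _ do rewrite mulrCA mulr_sumr.
rewrite -mulr_sumr exchange_big; congr (_ * _); apply: eq_bigr => b _ /=.
by rewrite mulr_sumr; apply: eq_bigr => t _; rewrite mulrCA.
Qed.

Lemma cvg_step_exp (F : nat -> S * A -> R) f y :
  (forall y', F n y' @[n --> \oo] --> f y') ->
  step_exp (F n) y @[n --> \oo] --> step_exp f y.
Proof.
move=> Ff; rewrite /step_exp.
apply: cvg_big => [|s' _]; first exact: add_continuous.
apply: (cvgM (cvg_cst _)); apply: cvg_big => [|b _]; first exact: add_continuous.
exact: cvgM (cvg_cst _) (Ff _).
Qed.

Section discounted_value.
Variables (gamma : R) (g : S * A -> R).
Hypothesis hgamma : 0 <= gamma < 1.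

Let gB y : `|g y| <= \sum_y' `|g y'|.
Proof. by rewrite (bigD1 y)//= lerDl sumr_ge0. Qed.

(** Defined by operator powers and not as an expectation, so that its Bellman equation needs only
    algebra and a limit; [expectation_discounted] ties it to the process. *)
Definition discounted_value y : R :=
  limn (fun n => \sum_(0 <= t < n) gamma ^+ t * iter t step_exp g y).

Let is_cvg_value y :
  cvgn (fun n => \sum_(0 <= t < n) gamma ^+ t * iter t step_exp g y).
Proof.
by apply: is_cvg_discounted => // t; exact: iter_step_exp_bound.
Qed.

Lemma discounted_value_eq y :
  discounted_value y = g y + gamma * step_exp discounted_value y.
Proof.
pose F n y := \sum_(0 <= t < n) gamma ^+ t * iter t step_exp g y.
(* Splitting off time 0 gives a recursion in [n], whose limit is the Bellman equation. *)
have FS n y' : F n.+1 y' = g y' + gamma * step_exp (F n) y'.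
  rewrite /F big_nat_recl//= expr0 mul1r; congr (_ + _).
  rewrite -step_exp_sum mulr_sumr; apply: eq_bigr => t _.
  by rewrite exprS mulrA.
apply/cvg_lim => //; rewrite -(cvg_shiftS (F^~ y)) /=.
under eq_fun do rewrite FS.
apply: cvgD; first exact: cvg_cst.
by apply: (cvgM (cvg_cst _)); apply: cvg_step_exp => y'; exact: is_cvg_value.
Qed.

(** * Expectations along a trajectory *)

Section process.
Variables (s : S) (tr : trajectory M pi s).

Let Z t w := (@state R S A M pi s tr t w, @action R S A M pi s tr t w).

Let mZ t y : measurable [set w | Z t w = y].
Proof.
rewrite (_ : mkset _ = [set w | state t w = y.1] `&` [set w | action t w = y.2]).
  apply: measurableI; [exact: measurable_state|exact: measurable_action].
by case: y => y b; apply/seteqP; split=> w /= [] <- <-.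
Qed.

Let cyl n z := [set w | forall t, (t <= n)%N -> Z t w = z t].

(** A cylinder of order [n.+1] reads this path only up to time [n.+1], so the constant tail
    prescribes just the next pair. *)
Let extend z n y t := if (t <= n)%N then z t else y.

Let cylS n z y : cyl n.+1 (extend z n y) = cyl n z `&` [set w | Z n.+1 w = y].
Proof.
apply/seteqP; split=> w /=.
  move=> H; split=> [t tn|]; first by rewrite H ?(leqW tn)// /extend tn.
  by rewrite H// /extend ltnn.
move=> [H Hy] t; rewrite leq_eqVlt => /orP[/eqP ->|]; first by rewrite /extend ltnn.
by rewrite ltnS => tn; rewrite H// /extend tn.
Qed.

Let mcyl n z : measurable (cyl n z).
Proof.
rewrite (_ : cyl n z = \bigcap_(t in [set` iota 0 n.+1]) [set w | Z t w = z t]).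
  by apply: fin_bigcap_measurable => // t _; exact: mZ.
have tE t : (t \in iota 0 n.+1) = (t <= n)%N by rewrite mem_iota.
by apply/seteqP; split=> w H t tn; apply: H; rewrite -?tE//; move: tn; rewrite -tE.
Qed.

Let cyl_prob n z : fine (prob tr (cyl n z)) =
  ((z 0%N).1 == s)%:R * (\prod_(t < n.+1) pi (z t).1 (z t).2)
  * \prod_(t < n) trans M (z t).1 (z t).2 (z t.+1).1.
Proof.
have := trajectory_law tr n (fun t => (z t).1) (fun t => (z t).2).
rewrite (_ : mkset _ = cyl n z) => [->//|].
by apply/seteqP; split=> w H t /H; rewrite /Z; case: (z t) => ? ? /= [-> ->].
Qed.

Let cyl_probS n z y : fine (prob tr (cyl n.+1 (extend z n y))) =
  fine (prob tr (cyl n z)) * trans M (z n).1 (z n).2 y.1 * pi y.1 y.2.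
Proof.
rewrite !cyl_prob big_ord_recr [in X in _ * X = _]big_ord_recr /=.
have ezn t : (t <= n)%N -> extend z n y t = z t by rewrite /extend => ->.
have eyn : extend z n y n.+1 = y by rewrite /extend ltnn.
rewrite eyn !ezn//.
under eq_bigr => i _ do rewrite ezn -1?ltnS//.
under [X in _ * (X * _) = _]eq_bigr => i _ do rewrite !ezn// 1?ltnW//.
ring.
Qed.

(* Conditioning on the next state-action pair splits a cylinder into longer
   ones, so induction on the delay [d] needs no sum over whole paths. *)
Let markov f d n z : \sum_y f y *
    fine (prob tr (cyl n z `&` [set w | Z (n + d) w = y]))
  = fine (prob tr (cyl n z)) * iter d step_exp f (z n).
Proof.
elim: d n z => [|d ih] n z.
  rewrite addn0 (bigD1 (z n))//= big1 => [|y yz].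
    rewrite addr0 mulrC; congr (fine (prob tr _) * _).
    by apply/seteqP; split=> [w []//|w Hw]; split=> //=; exact: Hw.
  rewrite (_ : _ `&` _ = set0) ?measure0 ?mulr0//.
  apply/seteqP; split=> [w [/= Hw Hy]|//]; move/eqP: yz; apply.
  by rewrite -Hy Hw.
under eq_bigr => y _.
  rewrite (prob_fibers _ (mZ n.+1)); last exact: measurableI.
  rewrite mulr_sumr.
  under eq_bigr => y' _ do rewrite setIAC -cylS addnS -addSn.
  over.
rewrite exchange_big /=.
under eq_bigr => y' _ do rewrite ih cyl_probS /extend ltnn -2!mulrA.
rewrite -mulr_sumr /step_exp; congr (_ * _).
under [RHS]eq_bigr => s' _ do rewrite mulr_sumr.
by rewrite pair_bigA; apply: eq_bigr => -[].
Qed.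

(** [markov] at [n = 0] leaves a sum over initial pairs, whose law is the indicator of [s] times
    [pi]. *)
Lemma expectation_iter_step f t : ('E_(prob tr)[fun w => f (state t w, action t w)]
  = (\sum_(a : A) pi s a * iter t step_exp f (s, a))%:E)%E.
Proof.
rewrite (expectation_finite_valued _ (mZ t) f); congr EFin.
under eq_bigr => y _.
  rewrite (prob_fibers _ (mZ 0)); last exact: mZ.
  rewrite mulr_sumr; under eq_bigr => y' _.
    rewrite setIC (_ : [set w | Z 0 w = y'] = cyl 0 (fun=> y')).
      over.
    by apply/seteqP; split=> w; [move=> H t'; rewrite leqn0 => /eqP->|exact].
  over.
rewrite exchange_big /=; under eq_bigr => y' _.
  rewrite (markov f t 0) cyl_prob big_ord1 big_ord0 mulr1.
  over.
transitivity (\sum_(s' : S) \sum_(b : A)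
    (s' == s)%:R * pi s' b * iter t step_exp f (s', b)).
  by rewrite pair_bigA; apply: eq_bigr => -[].
rewrite (bigD1 s)//= [X in _ + X]big1 => [|s' /negbTE ->]; last first.
  by rewrite big1// => b _; rewrite !mul0r.
by rewrite addr0; apply: eq_bigr => b _; rewrite eqxx mul1r.
Qed.

(** The partial sums are bounded uniformly in [n] and [w], so dominated convergence moves the limit
    out of the expectation; each term is then [expectation_iter_step]. *)
Lemma expectation_discounted :
  'E_(prob tr)[fun w => (limn (fun n => \sum_(0 <= t < n) gamma ^+ t *
     g (state t w, action t w)))%R]%E
  = (\sum_(a : A) pi s a * discounted_value (s, a))%:E.
Proof.
rewrite unlock.
pose h n w := \sum_(0 <= t < n) gamma ^+ t * g (Z t w).
have mg t : measurable_fun setT (fun w => g (Z t w)).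
  exact: (measurable_finite_valued (mZ t)).
have mh n : measurable_fun setT (h n).
  by apply: measurable_sum => t; exact: measurable_funM (measurable_cst _) (mg t).
have h_cvg w : h n w @[n --> \oo] --> limn (h ^~ w).
  by apply: is_cvg_discounted.
have h_bound n w := discounted_bound hgamma (fun t => gB (Z t w)) n.
have [||||| _ _ cvgE] := @dominated_convergence _ _ _ (prob tr) _ measurableT
  (fun n w => (h n w)%:E) (fun w => (limn (h ^~ w))%:E)
  (cst ((\sum_y' `|g y'|) / (1 - gamma))%:E).
- by move=> n; exact/measurable_EFinP.
- by apply/measurable_EFinP; exact: measurable_fun_cvg mh (fun w _ => h_cvg w).
- by apply: aeW => w _; apply: cvg_EFin; [exact: nearW|exact: h_cvg].
- exact: finite_measure_integrable_cst.
- by apply: aeW => w n _; rewrite lee_fin; exact: h_bound.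
rewrite -(cvg_lim _ cvgE)//; apply/cvg_lim => //.
rewrite (_ : [sequence _]_n = fun n => (\sum_(a : A) pi s a *
  \sum_(0 <= t < n) gamma ^+ t * iter t step_exp g (s, a))%:E).
  apply: cvg_EFin; first exact: nearW.
  apply: cvg_big => [|a _]; first exact: add_continuous.
  by apply: cvgM; [exact: cvg_cst|exact: is_cvg_value].
apply/funext => n /=.
have ig t : (prob tr).-integrable setT (fun w => (g (Z t w))%:E).
  apply: (le_integrable measurableT)
    (finite_measure_integrable_cst _ (\sum_y' `|g y'|) measurableT).
    exact/measurable_EFinP.
  by move=> w _; rewrite lee_fin /= (le_trans (gB _))// ler_norm.
transitivity (\int[prob tr]_w \sum_(0 <= t < n)
    ((gamma ^+ t)%:E * (g (Z t w))%:E))%E.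
  by apply: eq_integral => w _; rewrite /h -sumEFin.
rewrite integral_sum// => [|t]; last exact: integrableZl.
under [X in _ = X%:E]eq_bigr => a _ do rewrite mulr_sumr.
rewrite exchange_big -sumEFin; apply: eq_bigr => t _ /=.
rewrite integralZl//; have := expectation_iter_step g t; rewrite unlock => ->.
rewrite -EFinM mulr_sumr; congr EFin; apply: eq_bigr => a _.
by rewrite mulrCA.
Qed.

End process.
End discounted_value.
End trajectory_bellman.

(** * The Bellman equation of a policy *)

Section bellman.
Variables (R : realType) (S A : finType) (M : mdp R S A) (tau : R).
Hypothesis hgamma : 0 <= discount M < 1.

Lemma Vreg_bellman (pi : policy R S A) s : Vreg M tau pi s =
  \sum_(a : A) pi s a * (Qreg M tau pi s a - tau * ln (pi s a)).
Proof.
(* The entropy bonus joins the reward in one function of the pair, so the regularized value is an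
   ordinary discounted value. *)
pose g (y : S * A) := reward M y.1 y.2 - tau * ln (pi y.1 y.2).
have VE s' : Vreg M tau pi s' =
    \sum_(a : A) pi s' a * discounted_value M pi (discount M) g (s', a).
  by rewrite /Vreg (expectation_discounted g hgamma (traj M pi s')).
rewrite VE; apply: eq_bigr => a _; congr (_ * _).
rewrite discounted_value_eq// /g /= /Qreg addrAC; congr (_ + _ * _ + _).
by apply: eq_bigr => s' _; rewrite VE.
Qed.

End bellman.

(** * Gibbs distributions and log-sum-exp *)

Section gibbs.
(* [p0] only witnesses that [T] is inhabited. *)
Variables (R : realType) (T : finType) (p0 : dist R T).
Implicit Types (p : dist R T) (q : T -> R).

Definition partition_function q : R := \sum_x expR (q x).

Lemma partition_function_gt0 q : 0 < partition_function q.
Proof.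
have [x _|T0] := pickP (fun _ : T => true); last first.
  have := Defs.pmf_sum1 p0; rewrite big_pred0// => /eqP.
  by rewrite eq_sym oner_eq0.
rewrite /partition_function (bigD1 x)//= ltr_wpDr ?expR_gt0//.
by apply: sumr_ge0 => y _; exact: expR_ge0.
Qed.

Fact gibbs_ge0 q x : 0 <= expR (q x) / partition_function q.
Proof. by rewrite divr_ge0 ?expR_ge0// ltW// partition_function_gt0. Qed.

Fact gibbs_sum1 q : \sum_x expR (q x) / partition_function q = 1.
Proof. by rewrite -mulr_suml divff// gt_eqF// partition_function_gt0. Qed.

Definition gibbs q : dist R T := Dist (gibbs_ge0 q) (gibbs_sum1 q).

Lemma ln_gibbs q x : ln (gibbs q x) = q x - ln (partition_function q).
Proof.
rewrite /= ln_div ?posrE ?expR_gt0 ?partition_function_gt0//.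
by rewrite expRK.
Qed.

Lemma gibbs_free_energy q :
  \sum_x gibbs q x * (q x - ln (gibbs q x)) = ln (partition_function q).
Proof.
rewrite -[RHS](mean_cst (gibbs q)); apply: eq_bigr => x _.
by rewrite ln_gibbs subKr.
Qed.

(** Gibbs variational principle: the gap is the Kullback-Leibler divergence from [p] to [gibbs q],
    nonnegative because [ln u <= u - 1]. *)
Lemma free_energy_le p q :
  \sum_x p x * (q x - ln (p x)) <= ln (partition_function q).
Proof.
suff : \sum_x (p x * (q x - ln (p x)) - p x * ln (partition_function q)) <=
    \sum_x (gibbs q x - p x).
  by rewrite !sumrB mean_cst !Defs.pmf_sum1 subrr subr_le0.
apply: ler_sum => x _; rewrite -mulrBr addrAC -ln_gibbs.
(* Where [p x = 0] the ratio to [p x] is meaningless, but the term vanishes and [gibbs q x >= 0]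
   suffices. *)
have [->|px0] := eqVneq (p x) 0.
  by rewrite mul0r subr0; exact: Defs.pmf_ge0.
have px_gt0 : 0 < p x by rewrite lt0r px0; exact: Defs.pmf_ge0.
have gx_gt0 : 0 < gibbs q x.
  by rewrite /= divr_gt0 ?expR_gt0// partition_function_gt0.
rewrite -ln_div ?posrE// -[gibbs q x / p x](subrKC 1).
apply: (@le_trans _ _ (p x * (gibbs q x / p x - 1))).
  apply: ler_wpM2l; first exact: ltW.
  by apply: le_ln1Dx; rewrite ltrBrDr addrC subrr divr_gt0.
by rewrite mulrBr mulr1 mulrCA divff// mulr1.
Qed.

(** Inverting the Taylor bound [1 + y + y^2/2 <= exp y] suffices, since [(1 - y + y^2/2) (1 + y +
    y^2/2) = 1 + y^4/4]. *)
Lemma expR_le_quadratic (y : R) : 0 <= y -> expR (- y) <= 1 - y + y ^+ 2 / 2.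
Proof.
move=> y0; have ey : 1 + y + y ^+ 2 / 2 <= expR y.
  have -> : 1 + y + y ^+ 2 / 2 = series (exp_coeff y) 3.
    rewrite /series /= !big_nat_recr//= big_nil /exp_coeff /=.
    by rewrite expr0 expr1 !factS fact0 !divr1 add0r.
  rewrite /expR.
  apply: nondecreasing_cvgn_le; last exact: is_cvg_series_exp_coeff.
  by apply: nondecreasing_series => n _ _; rewrite exp_coeff_ge0.
rewrite expRN -div1r ler_pdivrMr ?expR_gt0//.
apply: (@le_trans _ _ ((1 - y + y ^+ 2 / 2) * (1 + y + y ^+ 2 / 2))).
  have : 0 <= y ^+ 4 by rewrite exprn_ge0.
  nra.
apply: ler_wpM2l => //; nra.
Qed.

(* The Hessian of [ln (partition_function _)] is a covariance matrix, hence the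
   quadratic error. *)
Lemma ln_partition_function_smooth q q' d :
  (forall x, 0 <= q' x - q x <= d) ->
  ln (partition_function q') <=
  ln (partition_function q) + \sum_x gibbs q x * (q' x - q x) + d ^+ 2 / 2.
Proof.
move=> qd; set m := \sum_x _.
have Z0 := partition_function_gt0 q.
rewrite -addrA -[_ + _ / 2]expRK -lnM ?posrE ?expR_gt0//.
rewrite ler_ln ?posrE ?mulr_gt0 ?expR_gt0 ?partition_function_gt0//.
rewrite -ler_pdivrMl// mulrC.
have -> : partition_function q' / partition_function q =
    \sum_x gibbs q x * expR (q' x - q x).
  rewrite mulr_suml; apply: eq_bigr => x _ /=.
  by rewrite mulrAC -expRD subrKC.
(* For [h = q' x - q x], write [exp h = exp d * exp (- (d - h))], apply the quadratic bound at
   [y = d - h] and use [y^2 <= d^2]. The result is affine in [h], so its mean involves only [m];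
   [1 + u <= exp u] then concludes. *)
apply: (@le_trans _ _ (\sum_x gibbs q x *
    (expR d * (1 - d + d ^+ 2 / 2) + expR d * (q' x - q x)))).
  apply: ler_mean => x; have /andP[h0 hd] := qd x.
  have -> : q' x - q x = d - (d - (q' x - q x)) by rewrite subKr.
  rewrite expRD -mulrDr ler_wpM2l ?expR_ge0//.
  apply: le_trans (expR_le_quadratic _) _; rewrite ?subr_ge0//.
  have : (d - (q' x - q x)) ^+ 2 <= d ^+ 2.
    by rewrite ler_pXn2r// ?nnegrE ?subr_ge0// ?gerBl// (le_trans h0).
  lra.
rewrite mean_affine -/m -mulrDr.
have -> : m + d ^+ 2 / 2 = d + (- d + m + d ^+ 2 / 2) by ring.
rewrite expRD ler_wpM2l ?expR_ge0// (le_trans _ (expR_ge1Dx _))//.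
lra.
Qed.

End gibbs.

(** * Soft Bellman operators and one step of soft policy iteration *)

Section soft_policy_iteration.
Variables (R : realType) (S A : finType) (M : mdp R S A) (tau : R).
Hypotheses (htau : 0 < tau) (hgamma : 0 <= discount M < 1).
Variable pi0 : policy R S A.
Local Notation gamma := (discount M).
Implicit Types (pi : policy R S A) (U V D : S -> R).

Definition action_value V s a : R :=
  reward M s a + gamma * \sum_(s' : S) trans M s a s' * V s'.

Definition policy_backup pi V s : R :=
  \sum_(a : A) pi s a * (action_value V s a - tau * ln (pi s a)).

(** The soft Bellman optimality operator: by the Gibbs principle, the maximum of [policy_backup]
    over policies, attained at the softmax. *)
Definition soft_backup V s : R :=
  tau * ln (partition_function (fun a => action_value V s a / tau)).

Definition next_mean pi D s : R :=
  \sum_(a : A) pi s a * \sum_(s' : S) trans M s a s' * D s'.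

Definition greedy_policy V : policy R S A :=
  fun s => gibbs (pi0 s) (fun a => action_value V s a / tau).

(** Equality of masses and not of [dist] records: this is what [soft_PI] provides. *)
Definition soft_greedy pi V :=
  forall s a, pi s a = greedy_policy V s a.

Let gamma0 : 0 <= gamma. Proof. by case/andP: hgamma. Qed.
Let gamma1 : 0 < 1 - gamma. Proof. by case/andP: hgamma; rewrite subr_gt0. Qed.

Let tauE V s a (x : R) : action_value V s a - tau * x =
  tau * (action_value V s a / tau - x).
Proof. by rewrite mulrBr mulrCA divff ?mulr1// gt_eqF. Qed.

Lemma Vreg_backup pi s : Vreg M tau pi s = policy_backup pi (Vreg M tau pi) s.
Proof. exact: Vreg_bellman. Qed.

Lemma policy_backup_le pi V s : policy_backup pi V s <= soft_backup V s.
Proof.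
rewrite /policy_backup; under eq_bigr => a _ do rewrite tauE mulrCA.
by rewrite -mulr_sumr ler_pM2l//; exact: (free_energy_le (pi s)).
Qed.

Lemma policy_backup_greedy pi V s : soft_greedy pi V ->
  policy_backup pi V s = soft_backup V s.
Proof.
move=> pV; rewrite /policy_backup /soft_backup -(gibbs_free_energy (pi0 s)).
by rewrite mulr_sumr; apply: eq_bigr => a _; rewrite tauE mulrCA pV.
Qed.

Lemma action_valueB U V s a : action_value U s a - action_value V s a =
  gamma * \sum_(s' : S) trans M s a s' * (U s' - V s').
Proof.
rewrite /action_value opprD addrACA subrr add0r -mulrBr -sumrB.
by congr (_ * _); apply: eq_bigr => s' _; rewrite mulrBr.
Qed.

Lemma policy_backupB pi U V s : policy_backup pi U s - policy_backup pi V s =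
  gamma * next_mean pi (fun s' => U s' - V s') s.
Proof.
rewrite -sumrB mulr_sumr; apply: eq_bigr => a _.
by rewrite -mulrBr [RHS]mulrCA -action_valueB; ring.
Qed.

Lemma next_mean_le pi D c s : (forall s', D s' <= c) -> next_mean pi D s <= c.
Proof.
move=> Dc; rewrite -[leRHS](mean_cst (pi s)); apply: ler_mean => a.
by rewrite -[leRHS](mean_cst (trans M s a)); exact: ler_mean.
Qed.

(** Maximum principle: at a state [m] maximizing [D], the mean of [D] is at most [D m], whence
    [(1 - gamma) * D m <= c]. *)
Lemma fixpoint_le pi D c : (forall s, D s <= c + gamma * next_mean pi D s) ->
  forall s, D s <= c / (1 - gamma).
Proof.
move=> Dc s; pose m := [arg max_(i > s) D i]%O.
have Dm s' : D s' <= D m.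
  by rewrite /m; case: arg_maxP => // i _; exact.
apply: le_trans (Dm s) _; rewrite ler_pdivlMr// mulrBr mulr1 lerBlDr.
apply: le_trans (Dc m) _; rewrite lerD2l [leRHS]mulrC.
by apply: ler_wpM2l => //; exact: next_mean_le.
Qed.

Lemma policy_backup_mono pi U V s : (forall s', U s' <= V s') ->
  policy_backup pi U s <= policy_backup pi V s.
Proof.
move=> UV; rewrite -subr_le0 policy_backupB mulr_ge0_le0//.
by apply: next_mean_le => s'; rewrite subr_le0.
Qed.

(** The policy greedy for [U] attains the backup of [U] and is at best optimal for [V], so the
    difference is bounded by that of one affine backup. *)
Lemma soft_backup_sub_le U V c s : (forall s', U s' - V s' <= c) ->
  soft_backup U s - soft_backup V s <= gamma * c.
Proof.
move=> UVc; rewrite -(@policy_backup_greedy (greedy_policy U) U)//.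
apply: (@le_trans _ _ (policy_backup (greedy_policy U) U s -
                       policy_backup (greedy_policy U) V s)).
  by rewrite lerB// policy_backup_le.
by rewrite policy_backupB ler_wpM2l// next_mean_le.
Qed.

Lemma policy_backup_le_Vreg pi V : (forall s, V s <= policy_backup pi V s) ->
  forall s, V s <= Vreg M tau pi s.
Proof.
move=> hV s; rewrite -subr_le0 -(mul0r (1 - gamma)^-1).
apply: (@fixpoint_le pi (fun s => V s - Vreg M tau pi s)) => {}s.
by rewrite add0r -policy_backupB -Vreg_backup lerB.
Qed.

(** Makes the supremum in [Vopt] a genuine upper bound. By the Bellman equation, [Vreg] minus its
    discounted next mean is the policy backup of the zero function, at most [soft_backup] of zero,
    which is independent of [pi]. *)
Lemma Vreg_bounded : exists B, forall pi s, Vreg M tau pi s <= B.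
Proof.
pose K := \sum_s `|soft_backup (fun=> 0) s|; exists (K / (1 - gamma)) => pi.
apply: (@fixpoint_le pi) => s; rewrite Vreg_backup -lerBlDr.
have -> : next_mean pi (Vreg M tau pi) =
    next_mean pi (fun s' => Vreg M tau pi s' - 0).
  by congr next_mean; apply/funext => s'; rewrite subr0.
rewrite -policy_backupB subKr (le_trans (policy_backup_le _ _ _))//.
by rewrite (le_trans (ler_norm _))// /K (bigD1 s)//= lerDl sumr_ge0.
Qed.

Lemma Vreg_le_Vopt pi s : Vreg M tau pi s <= Vopt M tau s.
Proof.
have [B hB] := Vreg_bounded.
apply: ub_le_sup; last by exists pi.
by exists B => _ [pi' _ <-].
Qed.

Lemma Vopt_le_backup s : Vopt M tau s <= soft_backup (Vopt M tau) s.
Proof.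
apply: ge_sup => [|_ [pi _ <-]]; first by exists (Vreg M tau pi0 s), pi0.
rewrite Vreg_backup (le_trans _ (policy_backup_le pi _ _))//.
by apply: policy_backup_mono => s'; exact: Vreg_le_Vopt.
Qed.

(** [Vopt] is a subsolution for its own greedy policy, whose value therefore reaches [Vopt] at all
    states at once; the equation is then that policy's Bellman equation. *)
Lemma Vopt_fixpoint s : Vopt M tau s = soft_backup (Vopt M tau) s.
Proof.
pose pi := greedy_policy (Vopt M tau).
have VE : Vopt M tau =1 Vreg M tau pi.
  move=> s'; apply/eqP; rewrite eq_le Vreg_le_Vopt andbT.
  move: s'; apply: policy_backup_le_Vreg => s'.
  by rewrite policy_backup_greedy// Vopt_le_backup.
rewrite -(@policy_backup_greedy pi)// VE Vreg_backup /policy_backup.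
by rewrite (_ : Vopt M tau = Vreg M tau pi)//; exact/funext.
Qed.

Section step.
Variables (pi pi' : policy R S A) (e : R).
Hypothesis greedy : soft_greedy pi' (Vreg M tau pi).
Hypothesis err : forall s, Vopt M tau s - Vreg M tau pi s <= e.

(** Policy improvement: [Vreg] of [pi] is a subsolution for [pi'], hence below the value of [pi'];
    applying the monotone backup of [pi'] once more gives the claim. *)
Let improvement s : soft_backup (Vreg M tau pi) s <= Vreg M tau pi' s.
Proof.
rewrite -(policy_backup_greedy _ greedy) [leRHS]Vreg_backup.
apply: policy_backup_mono; apply: policy_backup_le_Vreg => s'.
by rewrite policy_backup_greedy// [leLHS]Vreg_backup policy_backup_le.
Qed.

Lemma soft_PI_linear s : Vopt M tau s - Vreg M tau pi' s <= gamma * e.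
Proof.
rewrite Vopt_fixpoint; apply: le_trans (soft_backup_sub_le s err).
by rewrite lerB.
Qed.

(** Since [pi'] is the gradient of log-sum-exp at the action values of [pi], the defect of [Vopt] in
    the Bellman equation of [pi'] is a first-order Taylor remainder. Smoothness with
    [d = gamma * e / tau] bounds it by [tau * d^2 / 2], and [fixpoint_le] divides by [1 - gamma]. *)
Lemma soft_PI_quadratic s : Vopt M tau s - Vreg M tau pi' s <=
  gamma ^+ 2 / (2 * tau * (1 - gamma)) * e ^+ 2.
Proof.
have -> : gamma ^+ 2 / (2 * tau * (1 - gamma)) * e ^+ 2 =
    tau * ((gamma * e / tau) ^+ 2 / 2) / (1 - gamma).
  by field; rewrite !gt_eqF.
apply: (@fixpoint_le pi' (fun s => Vopt M tau s - Vreg M tau pi' s)) => {}s.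
rewrite -policy_backupB -Vreg_backup addrA lerD2r Vopt_fixpoint.
set V := Vreg M tau pi; set U := Vopt M tau.
have UE : policy_backup pi' U s = soft_backup V s +
    \sum_(a : A) pi' s a * (action_value U s a - action_value V s a).
  rewrite -(policy_backup_greedy _ greedy) -big_split; apply: eq_bigr => a _ /=.
  by rewrite -mulrDr; congr (_ * _); rewrite /V; ring.
have avB a : 0 <= action_value U s a / tau - action_value V s a / tau <=
    gamma * e / tau.
  rewrite -mulrBl action_valueB divr_ge0 ?(ltW htau)//=; last first.
    rewrite mulr_ge0// -[leLHS](mean_cst (trans M s a)); apply: ler_mean => s'.
    by rewrite subr_ge0 Vreg_le_Vopt.
  rewrite ler_wpM2r ?invr_ge0 ?(ltW htau)// ler_wpM2l//.
  by rewrite -[leRHS](mean_cst (trans M s a)); exact: ler_mean.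
have := ln_partition_function_smooth (pi0 s) avB.
rewrite -(ler_pM2l htau) !mulrDr -/(soft_backup U s) -/(soft_backup V s).
rewrite UE mulr_sumr => h.
have -> : \sum_(a : A) pi' s a * (action_value U s a - action_value V s a) =
    \sum_(a : A) tau * (gibbs (pi0 s) (fun a => action_value V s a / tau) a *
      (action_value U s a / tau - action_value V s a / tau)).
  apply: eq_bigr => a _; rewrite greedy mulrCA; congr (_ * _).
  by rewrite -mulrBl mulrCA divff ?mulr1// gt_eqF.
by rewrite [leRHS]addrC.
Qed.

End step.
End soft_policy_iteration.

(** * The maximum norm *)

Section norm_infty.
Variables (R : realType) (S : finType).
Implicit Types (f : S -> R).

Lemma norm_infty_ge f s : `|f s| <= norm_infty f.
Proof. exact: le_bigmax. Qed.

Lemma norm_infty_ge0 f : 0 <= norm_infty f.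
Proof. exact: bigmax_ge_id. Qed.

Lemma norm_infty_le f c : 0 <= c -> (forall s, `|f s| <= c) -> norm_infty f <= c.
Proof. by move=> c0 fc; apply/bigmax_leP. Qed.

End norm_infty.

(** * From linear and quadratic recursions to doubly exponential decay *)

Section doubly_exponential.
Variables (R : realType) (gamma : R) (a : nat -> R).
Hypotheses (hgamma : 0 < gamma < 1) (a_ge0 : forall k, 0 <= a k).
Hypothesis a_linear : forall k, a k.+1 <= gamma * a k.
Hypothesis a_quadratic : forall k, a k.+1 <= a k ^+ 2.

Let g0 : 0 < gamma. Proof. by case/andP: hgamma. Qed.
Let g1 : gamma < 1. Proof. by case/andP: hgamma. Qed.

Lemma geometric_decay k : a k <= gamma ^+ k * a 0%N.
Proof.
elim: k => [|k ih]; first by rewrite expr0 mul1r.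
apply: le_trans (a_linear k) _; rewrite exprS -mulrA.
by apply: (ler_wpM2l (ltW g0)) ih.
Qed.

(** Squaring gains nothing at 1, so one linear step first brings the error to [gamma]; this costs
    the extra index in [j.+1]. *)
Lemma doubly_exponential_decay m j : a m <= 1 ->
  a (m + j.+1)%N <= gamma ^+ (2 ^ j).
Proof.
move=> am1; elim: j => [|j ih].
  by rewrite addn1 expn0 expr1 (le_trans (a_linear m))// ler_piMr// ltW.
rewrite addnS (le_trans (a_quadratic _))// expnS mulnC exprM.
by apply: lerXn2r ih; rewrite nnegrE// exprn_ge0// ltW.
Qed.

Lemma doubly_exponential_decay_threshold (k : nat) :
  let k0 := if a 0%N <= 1 then 1 else 2 + ln (a 0%N) / ln (1 / gamma) in
  k0 <= k%:R -> a k <= gamma `^ (2 `^ (k%:R - k0)).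
Proof.
move=> k0 kk0.
(* From [m + 1 <= k0] follows [k - k0 <= j], and powers of [gamma < 1] decrease in the exponent. *)
suff [m [j [-> am1 mk0]]] : exists m j,
    [/\ k = (m + j.+1)%N, a m <= 1 & m.+1%:R <= k0].
  rewrite (le_trans (doubly_exponential_decay _ am1))//.
  rewrite -powR_mulrn ?(ltW g0)// ger_powR ?g0 ?(ltW g1)//.
  rewrite natrX -powR_mulrn// ler_powR ?ler1n//.
  by rewrite addnS -addSn natrD lerBlDl lerD2r.
move: kk0; rewrite /k0; case: (leP (a 0%N) 1) => a01 kk0.
  have k_gt0 : (0 < k)%N by rewrite -(ler1n R).
  by exists 0%N, k.-1; rewrite add0n prednK.
have l0 : 0 < ln (1 / gamma) by rewrite ln_gt0// div1r invf_gt1.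
have a0 : 0 < a 0%N by rewrite (lt_trans ltr01).
set x := ln _ / _ in kk0 *.
have x0 : 0 <= x by rewrite divr_ge0 ?ltW// ln_gt0.
(* [x] is the real time at which [gamma^x * a 0 = 1]. Rounding gives [x < m <= x + 1]: the left part
   yields [a m <= 1], the right one the constant 2 in [k0]. *)
pose m := (Num.truncn x).+1.
have xm : x < m%:R by exact: truncnS_gt.
have mx : m.+1%:R <= 2 + x.
  by rewrite /m -addn2 natrD addrC lerD2l truncn_le.
exists m, (k - m.+1)%N; split=> //.
  by rewrite addnS -addSn subnKC// -(ler_nat R) (le_trans mx).
rewrite (le_trans (geometric_decay m))//.
rewrite -ler_ln ?posrE ?mulr_gt0 ?exprn_gt0// ln1 lnM ?posrE ?exprn_gt0//.
move: (ltW xm); rewrite /x ler_pdivrMr// div1r lnV ?posrE// lnXn// => h.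
by rewrite -mulr_natl -[X in X + _]opprK -mulrN addrC subr_le0.
Qed.

End doubly_exponential.

(** * Doubly exponential convergence of soft policy iteration *)

Theorem theorem6p13 (R : realType) (S A : finType) (M : mdp R S A) (tau : R)
    (htau : 0 < tau) (hgamma : 0 < discount M < 1)
    (pi : nat -> policy R S A) (hpi : soft_PI M tau pi) :
  let gamma := discount M in
  let a0 := 1 / (2 * tau) * (gamma ^+ 2 / (1 - gamma))
            * norm_infty (fun s => Vopt M tau s - Vreg M tau (pi 0%N) s) in
  let k0 := if a0 <= 1 then 1 else 2 + ln a0 / ln (1 / gamma) in
  forall k : nat, k0 <= k%:R ->
    norm_infty (fun s => Vopt M tau s - Vreg M tau (pi k) s)
    <= 2 * tau * (1 - gamma) / gamma ^+ 2 * (gamma `^ (2 `^ (k%:R - k0))).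
Proof.
move=> gamma a0 k0 k kk0.
have [g0 g1] := andP hgamma.
have hgamma' : 0 <= gamma < 1 by rewrite (ltW g0).
have g1' : 0 < 1 - gamma by rewrite subr_gt0.
pose e j := norm_infty (fun s => Vopt M tau s - Vreg M tau (pi j) s).
(* This scaling turns the quadratic bound into [C * e j.+1 <= (C * e j)^2]; its inverse is the
   prefactor of the claim. *)
pose C := 1 / (2 * tau) * (gamma ^+ 2 / (1 - gamma)).
have C0 : 0 < C by rewrite mulr_gt0 ?divr_gt0 ?mulr_gt0 ?exprn_gt0.
have e0 j : 0 <= e j by exact: norm_infty_ge0.
have greedy j : soft_greedy M tau (pi 0%N) (pi j.+1) (Vreg M tau (pi j)).
  by move=> s a; exact: hpi.
have gap_ge0 j s : 0 <= Vopt M tau s - Vreg M tau (pi j) s.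
  by rewrite subr_ge0 (Vreg_le_Vopt htau hgamma').
have gap_le j s : Vopt M tau s - Vreg M tau (pi j) s <= e j.
  by rewrite (le_trans (ler_norm _))//; exact: norm_infty_ge.
have e_linear j : e j.+1 <= gamma * e j.
  apply: norm_infty_le => [|s]; first by rewrite mulr_ge0 ?(ltW g0).
  by rewrite ger0_norm//; exact: soft_PI_linear (greedy j) (gap_le j) s.
have e_quadratic j : e j.+1 <= C * e j ^+ 2.
  have -> : C = gamma ^+ 2 / (2 * tau * (1 - gamma)).
    by rewrite /C; field; rewrite !gt_eqF.
  apply: norm_infty_le => [|s].
    by rewrite mulr_ge0 ?sqr_ge0// divr_ge0 ?sqr_ge0// !mulr_ge0 ?ltW.
  by rewrite ger0_norm//; exact: soft_PI_quadratic (greedy j) (gap_le j) s.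
have Ce : C * e k <= gamma `^ (2 `^ (k%:R - k0)).
  apply: (@doubly_exponential_decay_threshold _ _ (fun j => C * e j)) kk0 => // j.
  - by rewrite mulr_ge0 ?(ltW C0).
  - by rewrite mulrCA; apply: ler_wpM2l (e_linear j); exact: ltW.
  - by rewrite exprMn expr2 -mulrA; apply: ler_wpM2l (e_quadratic j); exact: ltW.
have -> : 2 * tau * (1 - gamma) / gamma ^+ 2 = C^-1.
  by rewrite /C; field; rewrite !gt_eqF.
by rewrite ler_pdivlMl.
Qed.
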